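(* Let $q\ge 1$ and $n$ be integers with $q\le n$. Every one-time oracle signature scheme $(\mathsf{Gen},\mathsf{Sign},\mathsf{Ver})$ for messages in $\{0,1\}^n$, relative to a random oracle, in which at most $q$ oracle queries are made in total by $\mathsf{Gen}$, $\mathsf{Sign}$ and $\mathsf{Ver}$, has black-box security at most $2^{(1+o(1))q}$, where the $o(1)$ term tends to $0$ as $q\to\infty$.
   Context: Random oracle: for each input length $\ell$, an independent uniformly random function $\{0,1\}^\ell\to\{0,1\}^\ell$, accessible only by queries. An oracle signature scheme for a message space $\mathcal{M}$ is a triple of oracle algorithms $(\mathsf{Gen},\mathsf{Sign},\mathsf{Ver})$, where $\mathsf{Gen}$ may be probabilistic, $\mathsf{Gen}^{\mathcal{O}}$ outputs a pair $(SK,VK)$ (signing and verification key), and (perfect completeness) for every oracle $\mathcal{O}$, every $(SK,VK)$ output by $\mathsf{Gen}^{\mathcal{O}}$ with positive probability, and every $\alpha\in\mathcal{M}$, $\mathsf{Ver}^{\mathcal{O}}(VK,\alpha,\mathsf{Sign}^{\mathcal{O}}(SK,\alpha))=1$. The total number of queries of the scheme is the total number of oracle queries made when generating keys, signing one message and verifying that signature. Black-box security $S$: for every message $\alpha\in\mathcal{M}$, every $1\le T\le S$, and every (computationally unbounded) adversary $A$ making at most $T$ oracle queries, the probability that $A^{\mathcal{O}}(VK,\mathsf{Sign}^{\mathcal{O}}(SK,\alpha))$ outputs a pair $(\alpha^*,\sigma^* )$ with $\alpha^*\neq\alpha$ and $\mathsf{Ver}^{\mathcal{O}}(VK,\alpha^*,\sigma^*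 )=1$ is at most $T/S$, where $(SK,VK)=\mathsf{Gen}^{\mathcal{O}}$ and the probability is over the oracle and the coins of all algorithms. ''Black-box security at most $S_0$'' means the scheme does not have black-box security $S$ for any $S> S_0$. *)

(* Defs.v *)
From HB Require Import structures.
From mathcomp Require Import all_boot all_order all_algebra.
From mathcomp Require Import all_classical all_reals all_analysis.

Set Implicit Arguments.
Unset Strict Implicit.
Unset Printing Implicit Defensive.

Import Order.TTheory GRing.Theory Num.Theory.
Import numFieldNormedType.Exports.

Local Open Scope classical_set_scope.
Local Open Scope ring_scope.
Local Open Scope ereal_scope.

Definition oracle := forall l : nat, {ffun l.-tuple bool -> l.-tuple bool}.

(* A deterministic oracle algorithm, identified with its (well-founded)
   query tree: the oracle is accessible only through [Query]. *)
Inductive oalg (A : Type) : Type :=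
| Ret of A
| Query (l : nat) of l.-tuple bool & (l.-tuple bool -> oalg A).

Fixpoint run (A : Type) (O : oracle) (t : oalg A) : A :=
  match t with
  | Ret a => a
  | Query l x k => run O (k (O l x))
  end.

Fixpoint nqueries (A : Type) (O : oracle) (t : oalg A) : nat :=
  match t with
  | Ret _ => 0
  | Query l x k => (nqueries O (k (O l x))).+1
  end.

(* Coins follow an arbitrary discrete distribution.  For key generation this
   is no restriction: query trees are finitely branching, hence finite, so that
   those with bit-string outputs form a countable set, and any randomized
   algorithm amounts to a distribution over this set.  For adversaries it is
   immaterial: a success probability averaged over coins, however distributed,
   is at most the supremum over deterministic adversaries. *)
Record randomized (R : realType) (A : Type) := Randomized {
  coins : probability nat R;
  with_coins :> nat -> A
}.

(* The families of events {O l = f} are independent over the lengths l, and for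
   each l the function O l is uniformly distributed. *)
Definition random_oracle (R : realType) (d : measure_display)
    (Omega : measurableType d) (P : probability Omega R)
    (O : Omega -> oracle) : Prop :=
  [/\ forall (l : nat) (f : {ffun l.-tuple bool -> l.-tuple bool}),
        measurable [set w | O w l = f],
      forall (l : nat) (f : {ffun l.-tuple bool -> l.-tuple bool}),
        P [set w | O w l = f] =
        ((#|{: {ffun l.-tuple bool -> l.-tuple bool}}|%:R : R)^-1)%:E
    & forall (s : seq nat) (f : oracle), uniq s ->
        P [set w | forall l, l \in s -> O w l = f l] =
        \prod_(l <- s) P [set w | O w l = f l] ].

Definition bitstring := seq bool.

Record oracle_signature_scheme (R : realType) (M : Type) := OracleSignature {
  gen : randomized R (oalg (bitstring * bitstring)); (* (SK, VK) *)
  sign : bitstring -> M -> oalg bitstring;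
  ver : bitstring -> M -> bitstring -> oalg bool;
  perfect_completeness :
    forall (O : oracle) (sk vk : bitstring) (alpha : M),
      0 < coins gen [set c | run O (gen c) = (sk, vk)] ->
      run O (ver vk alpha (run O (sign sk alpha))) = true
}.

(* Coins of probability zero are disregarded, as in [perfect_completeness]. *)
Definition total_queries_le (R : realType) (M : Type)
    (Sch : oracle_signature_scheme R M) (q : nat) : Prop :=
  forall (O : oracle) (c : nat) (alpha : M),
    0 < coins (gen Sch) [set c] ->
    let keys := run O (gen Sch c) in
    let sigma := run O (sign Sch keys.1 alpha) in
    (nqueries O (gen Sch c) + nqueries O (sign Sch keys.1 alpha)
     + nqueries O (ver Sch keys.2 alpha sigma) <= q)%N.

(* Takes VK and a signature of the given message; outputs a candidate forged
   message together with its signature. *)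
Definition adversary (R : realType) (M : Type) :=
  randomized R (bitstring -> bitstring -> oalg (M * bitstring)).

Definition adversary_queries_le (R : realType) (M : Type)
    (A : adversary R M) (T : nat) : Prop :=
  forall (O : oracle) (c : nat) (vk sigma : bitstring),
    (nqueries O (A c vk sigma) <= T)%N.

Definition forges (R : realType) (M : Type)
    (Sch : oracle_signature_scheme R M) (A : adversary R M) (alpha : M)
    (O : oracle) (cG cA : nat) : Prop :=
  let keys := run O (gen Sch cG) in
  let sigma := run O (sign Sch keys.1 alpha) in
  let forgery := run O (A cA keys.2 sigma) in
  forgery.1 <> alpha /\
  run O (ver Sch keys.2 forgery.1 forgery.2) = true.

Definition forging_probability (R : realType) (d : measure_display)
    (Omega : measurableType d) (P : probability Omega R) (O : Omega -> oracle)
    (M : Type) (Sch : oracle_signature_scheme R M) (A : adversary R M)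
    (alpha : M) : \bar R :=
  (P \x coins (gen Sch) \x coins A)
    [set w : Omega * nat * nat | forges Sch A alpha (O w.1.1) w.1.2 w.2].

Definition black_box_secure (R : realType) (d : measure_display)
    (Omega : measurableType d) (P : probability Omega R) (O : Omega -> oracle)
    (M : Type) (Sch : oracle_signature_scheme R M) (S : R) : Prop :=
  forall (alpha : M) (T : nat), (1 <= T)%N -> (T%:R <= S)%R ->
  forall A : adversary R M, adversary_queries_le A T ->
    forging_probability P O Sch A alpha <= (T%:R / S)%:E.

Definition black_box_security_at_most (R : realType) (d : measure_display)
    (Omega : measurableType d) (P : probability Omega R) (O : Omega -> oracle)
    (M : Type) (Sch : oracle_signature_scheme R M) (S0 : R) : Prop :=
  forall S : R, (S0 < S)%R -> ~ black_box_secure P O Sch S.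

(* Main.v *)
(** Fix a message alpha.  Call the queries of key generation and of signing
    alpha hidden, and say that beta <> alpha is covered when verifying beta makes
    only those hidden queries that verifying alpha makes too.  Among 2^q messages
    at least half are such that some other one is covered: the remaining ones
    form a family of pairs of sets (hidden but not verified, verified) that
    cross in both directions, and the total size of each pair is at most q.

    Given VK and a signature of alpha, the adversary verifies the signature and
    then learns, one after the other, the points that have conditional
    probability more than 1/(8q) of being hidden; 64 q^2 queries suffice except
    with probability 1/8.  It then picks a world (coins and oracle) consistent
    with what it has seen, and a message beta, and signs beta with the key of
    that world, answering the hidden queries of that world from it and all
    other ones from the true oracle.  Exchanging the values of the true and of
    the picked world outside of both sets of hidden queries and of the learned
    points preserves the distribution of independent consistent pairs.  After
    this exchange a covered beta, guessed with probability 2^-q, yields a forgery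
    unless signing and verifying it in the picked world hits an unlearned hidden
    query of the true one, which has probability at most 1/8.

    So O(q^2) queries succeed with probability 2^-q/8, which contradicts security
    above 2^(q + 18 sqrt q). *)
Require Import Defs.
From HB Require Import structures.
From mathcomp Require Import all_boot all_order all_algebra.
From mathcomp Require Import all_classical all_reals all_analysis.
From mathcomp Require Import zify ring lra.
Import Order.TTheory GRing.Theory Num.Theory.
Import numFieldNormedType.Exports.
Import boot.fintype boot.finset.

Set Implicit Arguments.
Unset Strict Implicit.
Unset Printing Implicit Defensive.

Local Open Scope ring_scope.

(** * Query trees *)

Definition point := {l : nat & l.-tuple bool}.

Definition pt (l : nat) (x : l.-tuple bool) : point := existT _ l x.

Fixpoint queries (A : Type) (O : oracle) (t : oalg A) : seq point :=
  match t with
  | Ret _ => [::]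
  | Query l x k => pt x :: queries O (k (O l x))
  end.

Definition agree (O O' : oracle) (s : seq point) : Prop :=
  forall l (x : l.-tuple bool), pt x \in s -> O l x = O' l x.

Lemma nqueriesE (A : Type) (O : oracle) (t : oalg A) :
  nqueries O t = size (queries O t).
Proof. by elim: t => [a|l x k IH] //=; rewrite IH. Qed.

Lemma agree_sub (O O' : oracle) (s s' : seq point) :
  {subset s <= s'} -> agree O O' s' -> agree O O' s.
Proof. by move=> ss' OO' l x /ss' /OO'. Qed.

Lemma agree_catl (O O' : oracle) (s s' : seq point) :
  agree O O' (s ++ s') -> agree O O' s.
Proof. by apply: agree_sub => p ps; rewrite mem_cat ps. Qed.

Lemma agree_catr (O O' : oracle) (s s' : seq point) :
  agree O O' (s ++ s') -> agree O O' s'.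
Proof. by apply: agree_sub => p ps; rewrite mem_cat ps orbT. Qed.

Lemma agree_cons (O O' : oracle) l (x : l.-tuple bool) (s : seq point) :
  O l x = O' l x -> agree O O' s -> agree O O' (pt x :: s).
Proof.
move=> OO'x OO's l' x'; rewrite inE => /predU1P[|/OO's//].
have h (p : point) : p = pt x ->
    O (projT1 p) (projT2 p) = O' (projT1 p) (projT2 p) by move=> ->.
exact: (h (pt x')).
Qed.

Lemma agree_run (A : Type) (O O' : oracle) (t : oalg A) :
  agree O O' (queries O t) -> run O' t = run O t.
Proof.
elim: t => [a|l x k IH] //= OO'.
rewrite -OO' ?mem_head//; apply: IH => l' x' x'P.
by apply: OO'; rewrite inE x'P orbT.
Qed.

Lemma agree_queries (A : Type) (O O' : oracle) (t : oalg A) :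
  agree O O' (queries O t) -> queries O' t = queries O t.
Proof.
elim: t => [a|l x k IH] //= OO'.
rewrite -OO' ?mem_head// IH// => l' x' x'P.
by apply: OO'; rewrite inE x'P orbT.
Qed.

Fixpoint obind (A B : Type) (t : oalg A) (f : A -> oalg B) : oalg B :=
  match t with
  | Ret a => f a
  | Query l x k => Query x (fun y => obind (k y) f)
  end.

Lemma run_obind (A B : Type) (O : oracle) (t : oalg A) (f : A -> oalg B) :
  run O (obind t f) = run O (f (run O t)).
Proof. by elim: t => [a|l x k IH] //=; rewrite IH. Qed.

Lemma nqueries_obind (A B : Type) (O : oracle) (t : oalg A) (f : A -> oalg B) :
  nqueries O (obind t f) = (nqueries O t + nqueries O (f (run O t)))%N.
Proof. by elim: t => [a|l x k IH] //=; rewrite IH. Qed.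

Fixpoint cap (A : Type) (d : A) (T : nat) (t : oalg A) : oalg A :=
  match t, T with
  | Ret a, _ => Ret a
  | Query _ _ _, 0 => Ret d
  | Query l x k, T'.+1 => Query x (fun y => cap d T' (k y))
  end.

Lemma nqueries_cap (A : Type) (O : oracle) (d : A) (T : nat) (t : oalg A) :
  (nqueries O (cap d T t) <= T)%N.
Proof. by elim: t T => [a|l x k IH] [|T] //=; rewrite ltnS. Qed.

Lemma run_cap (A : Type) (O : oracle) (d : A) (T : nat) (t : oalg A) :
  (nqueries O t <= T)%N -> run O (cap d T t) = run O t.
Proof. by elim: t T => [a|l x k IH] [|T] //=; rewrite ltnS => /IH. Qed.

Definition partial_oracle := forall l : nat, l.-tuple bool -> option (l.-tuple bool).

Fixpoint simulate (A : Type) (h : partial_oracle) (t : oalg A) : oalg A :=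
  match t with
  | Ret a => Ret a
  | Query l x k =>
      match h l x with
      | Some y => simulate h (k y)
      | None => Query x (fun y => simulate h (k y))
      end
  end.

Definition overlay (h : partial_oracle) (O : oracle) : oracle :=
  fun l => [ffun x => odflt (O l x) (h l x)].

Lemma run_simulate (A : Type) (h : partial_oracle) (O : oracle) (t : oalg A) :
  run O (simulate h t) = run (overlay h O) t.
Proof. by elim: t => [a|l x k IH] //=; rewrite ffunE; case: (h l x) => [y|] /=. Qed.

Lemma nqueries_simulate (A : Type) (h : partial_oracle) (O : oracle)
    (t : oalg A) :
  (nqueries O (simulate h t) <= nqueries (overlay h O) t)%N.
Proof.
elim: t => [a|l x k IH] //=; rewrite ffunE; case: (h l x) => [y|] /=.
  exact: leqW.
by rewrite ltnS.
Qed.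

(** * Crossing families of set pairs *)

Lemma card_crossing (X J : finType) (D : {set J}) (A B : J -> {set X}) (k : nat) :
  (forall i, i \in D -> [disjoint A i & B i]) ->
  (forall i, i \in D -> (#|A i| + #|B i| <= k)%N) ->
  (forall i j, i \in D -> j \in D -> i != j ->
     exists x, (x \in A i) && (x \in B j) || (x \in A j) && (x \in B i)) ->
  (#|D| <= 2 ^ k)%N.
Proof.
move=> dAB ABk cross.
pose E i := [set A i :|: S | S in powerset (~: (A i :|: B i))]%SET.
have memE i (S : {set X}) : i \in D -> S \in E i ->
    (A i \subset S) /\ [disjoint B i & S].
  move=> iD /imsetP[S0]; rewrite inE => S0P ->; split; first exact: subsetUl.
  apply/pred0P => x /=; apply/negP => /andP[xB]; rewrite inE => /orP[xA|xS].
    by have := disjointFr (dAB i iD) xA; rewrite xB.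
  by have := subsetP S0P x xS; rewrite !inE xB orbT.
have cardE i : i \in D -> #|E i| = (2 ^ (#|X| - (#|A i| + #|B i|)))%N.
  move=> iD; rewrite card_in_imset.
    rewrite card_powerset cardsCs setCK cardsU.
    by move: (dAB i iD); rewrite -setI_eq0 => /eqP ->; rewrite cards0 subn0.
  move=> S S'; rewrite !inE => SP S'P /setP eqSS'; apply/setP => x.
  have := eqSS' x; rewrite !inE; case: (boolP (x \in A i)) => //= xA _.
  have h (U : {set X}) : U \subset ~: (A i :|: B i) -> x \in U = false.
    by move=> /subsetP UP; apply/negP => /UP; rewrite !inE xA.
  by rewrite !h.
have disjE i j : i \in D -> j \in D -> i != j -> [disjoint E i & E j].
  move=> iD jD ij; have [x xP] := cross i j iD jD ij.
  apply/pred0P => S /=; apply/negP => /andP[/(memE i _ iD)[AiS BiS]].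
  move=> /(memE j _ jD)[AjS BjS].
  case/orP: xP => /andP[xA xB].
    by have := disjointFr BjS xB; rewrite (subsetP AiS).
  by have := disjointFr BiS xB; rewrite (subsetP AjS).
have sumE : (\sum_(i in D) #|E i| <= 2 ^ #|X|)%N.
  have -> : (\sum_(i in D) #|E i| = #|\bigcup_(i in D) E i|)%N.
    pose E' i := (if i \in D then E i else set0).
    have -> : (\bigcup_(i in D) E i = \bigcup_i E' i)%SET.
      by rewrite big_mkcond.
    rewrite -sum1_card partition_disjoint_bigcup.
      rewrite [LHS]big_mkcond; apply: eq_bigr => i _; rewrite /E'.
      by case: ifP => _; rewrite ?big_set0// sum1_card.
    move=> i j ij; rewrite /E'; case: ifP => iD; last by rewrite disjoints_subset sub0set.
    by case: ifP => jD; [exact: disjE|rewrite disjoint_sym disjoints_subset sub0set].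
  by rewrite -[X in (_ <= 2 ^ X)%N]cardsT -card_powerset; apply: subset_leq_card;
     apply/subsetP => S _; rewrite inE subsetT.
have ABX i : i \in D -> (#|A i| + #|B i| <= #|X|)%N.
  move=> iD; have := leq_card_setU (A i) (B i); move: (dAB i iD).
  by rewrite -leq_card_setU => /eqP <- _; exact: max_card.
have [kX|Xk] := leqP k #|X|; last first.
  have [->|[i0 i0D]] := set_0Vmem D; first by rewrite cards0.
  have h : (#|D| <= \sum_(i in D) #|E i|)%N.
    rewrite -sum1_card; apply: leq_sum => i iD.
    by rewrite cardE// expn_gt0.
  by apply: (leq_trans h); apply: (leq_trans sumE); rewrite leq_exp2l// ltnW.
rewrite -(leq_pmul2r (m := 2 ^ (#|X| - k))) ?expn_gt0// -expnD subnKC//.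
apply: leq_trans sumE; rewrite -sum_nat_const; apply: leq_sum => i iD.
by rewrite cardE// leq_exp2l// leq_sub2l// ABk.
Qed.

(* Two index sets that cross in both directions conflict at two distinct
   elements, so they still conflict once the least element of each support is
   forgotten; this saves one element over [card_crossing]. *)
Lemma card_biccrossing (X J : finType) (D : {set J}) (A B : J -> {set X}) (k : nat) :
  (forall i, i \in D -> [disjoint A i & B i]) ->
  (forall i, i \in D -> (#|A i| + #|B i| <= k.+1)%N) ->
  (forall i j, i \in D -> j \in D -> i != j ->
     exists x, (x \in A i) && (x \in B j)) ->
  (#|D| <= 2 ^ k)%N.
Proof.
move=> dAB ABk cross.
pose least i x := (x \in A i :|: B i) &&
  [forall y in A i :|: B i, (enum_rank x <= enum_rank y)%N].
pose m i := [set x | least i x]%SET.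
apply: (@card_crossing X J D (fun i => A i :\: m i) (fun i => B i :\: m i)).
- move=> i iD; apply/pred0P => x /=; rewrite !inE.
  apply/negP => /andP[/andP[_ xA] /andP[_ xB]].
  by have := disjointFr (dAB i iD) xA; rewrite xB.
- move=> i iD.
  have [/eqP AB0|[x0 x0P]] := set_0Vmem (A i :|: B i).
    move: AB0; rewrite setU_eq0 => /andP[/eqP -> /eqP ->].
    by rewrite !set0D cards0.
  case: (arg_minnP (P := fun x => x \in A i :|: B i)
    (fun x => nat_of_ord (enum_rank x)) x0P) => x xP xmin.
  have xm : x \in m i.
    by rewrite inE /least xP /=; apply/forall_inP => y; exact: xmin.
  have dD : [disjoint A i :\: m i & B i :\: m i].
    apply/pred0P => z /=; rewrite !inE.
    apply/negP => /andP[/andP[_ zA] /andP[_ zB]].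
    by have := disjointFr (dAB i iD) zA; rewrite zB.
  have e1 : #|A i :|: B i| = (#|A i| + #|B i|)%N.
    by apply/eqP; rewrite leq_card_setU dAB.
  have e2 : #|(A i :\: m i) :|: (B i :\: m i)| =
      (#|A i :\: m i| + #|B i :\: m i|)%N.
    by apply/eqP; rewrite leq_card_setU.
  rewrite -e2 -ltnS; apply: leq_trans (ABk i iD); rewrite -e1.
  apply: proper_card; apply/properP; split.
    by apply/subsetP => z; rewrite !inE => /orP[] /andP[_ ->]; rewrite ?orbT.
  by exists x => //; rewrite inE !in_setD xm.
- move=> i j iD jD ij.
  have [u /andP[uA uB]] := cross i j iD jD ij.
  have [v /andP[vA vB]] : exists x, (x \in A j) && (x \in B i).
    by apply: cross => //; rewrite eq_sym.
  have uv : u != v.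
    apply/negP => /eqP uv; have := disjointFr (dAB i iD) uA.
    by rewrite uv vB.
  have inj_least k1 x y : x \in m k1 -> y \in A k1 :|: B k1 ->
      (enum_rank x <= enum_rank y)%N.
    by rewrite inE => /andP[_ /forall_inP] h; exact: h.
  have uS k1 : k1 \in [:: i; j] -> u \in A k1 :|: B k1.
    by rewrite !inE => /orP[] /eqP ->; rewrite ?uA ?uB ?orbT.
  have vS k1 : k1 \in [:: i; j] -> v \in A k1 :|: B k1.
    by rewrite !inE => /orP[] /eqP ->; rewrite ?vA ?vB ?orbT.
  have nuv k1 k2 : k1 \in [:: i; j] -> k2 \in [:: i; j] ->
      u \in m k1 -> v \in m k2 -> False.
    move=> k1P k2P um vm; move/negP: uv; apply; apply/eqP.
    apply: enum_rank_inj; apply: val_inj; apply/eqP; rewrite eqn_leq.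
    by rewrite (inj_least _ _ _ um (vS _ k1P)) (inj_least _ _ _ vm (uS _ k2P)).
  have iI : i \in [:: i; j] by rewrite mem_head.
  have jI : j \in [:: i; j] by rewrite !inE eqxx orbT.
  case: (boolP ((u \in m i) || (u \in m j))) => [um|].
    exists v; apply/orP; right; rewrite !in_setD vA vB !andbT.
    by apply/andP; split; apply/negP => vm; case/orP: um => um;
      [exact: (nuv i j)|exact: (nuv j j)|exact: (nuv i i)|exact: (nuv j i)].
  rewrite negb_or => /andP[ui uj]; exists u; apply/orP; left.
  by rewrite !in_setD uA uB ui uj.
Qed.

(** * The attack over finitely many oracles and coins *)

Section FiniteAttack.

Variables (R : realType) (I F M : finType).
Variables (ext : F -> oracle) (mix : F -> F -> seq point -> F).
Hypothesis ext_inj :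
  forall f f', (forall l x, ext f l x = ext f' l x) -> f = f'.
Hypothesis mixE : forall f f' D l (x : l.-tuple bool),
  ext (mix f f' D) l x = if pt x \in D then ext f l x else ext f' l x.
Variable w : I -> R.
Hypothesis w_gt0 : forall i, 0 < w i.
Variables (g : I -> oalg (bitstring * bitstring))
  (sg : bitstring -> M -> oalg bitstring)
  (vr : bitstring -> M -> bitstring -> oalg bool).
Hypothesis complete : forall O i b,
  run O (vr (run O (g i)).2 b (run O (sg (run O (g i)).1 b))) = true.
Variable q : nat.
Hypothesis q_gt0 : (0 < q)%N.
Hypothesis q_bound : forall O i b,
  (nqueries O (g i) + nqueries O (sg (run O (g i)).1 b) +
   nqueries O (vr (run O (g i)).2 b (run O (sg (run O (g i)).1 b))) <= q)%N.
Variable M0 : {set M}.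
Hypothesis cardM0 : #|M0| = (2 ^ q)%N.

Local Notation world := (I * F)%type.

Definition keys (om : world) := run (ext om.2) (g om.1).
Definition sig (om : world) b := run (ext om.2) (sg (keys om).1 b).
Definition sign_queries (om : world) b := queries (ext om.2) (sg (keys om).1 b).
Definition ver_queries (om : world) b :=
  queries (ext om.2) (vr (keys om).2 b (sig om b)).
Definition hidden (om : world) b :=
  queries (ext om.2) (g om.1) ++ sign_queries om b.

Definition covered (om : world) a b :=
  all (fun p => (p \in hidden om a) ==> (p \in ver_queries om a))
    (ver_queries om b).

Definition good a (om : world) :=
  [exists b in M0, (b != a) && covered om a b].

Lemma size_hidden_ver om a :
  (size (hidden om a) + size (ver_queries om a) <= q)%N.
Proof. by rewrite size_cat -!nqueriesE q_bound. Qed.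

Lemma card_seq_sub_mem (T : choiceType) (s r : seq T) :
  (#|[set x : seq_sub s | val x \in r]%SET| <= size r)%N.
Proof.
rewrite cardE -(size_map val); apply: uniq_leq_size.
  by rewrite (map_inj_uniq val_inj) enum_uniq.
by move=> x /mapP[y]; rewrite mem_enum inE => yr ->.
Qed.

Lemma card_not_good om : (#|[set a in M0 | ~~ good a om]%SET| <= 2 ^ q.-1)%N.
Proof.
pose s := flatten [seq hidden om a ++ ver_queries om a | a <- enum M].
pose A a := [set x : seq_sub s |
  (val x \in hidden om a) && (val x \notin ver_queries om a)]%SET.
pose B a := [set x : seq_sub s | val x \in ver_queries om a]%SET.
have sP a p : p \in hidden om a ++ ver_queries om a -> p \in s.
  by move=> ps; apply/flattenP; exists (hidden om a ++ ver_queries om a) => //;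
     apply/mapP; exists a => //; rewrite mem_enum.
apply: (@card_biccrossing _ _ _ A B).
- move=> a _; apply/pred0P => x /=; rewrite !inE.
  by case: (val x \in ver_queries om a); rewrite ?andbF.
- move=> a _; rewrite prednK//; apply: leq_trans (size_hidden_ver om a).
  apply: leq_add; last exact: card_seq_sub_mem.
  apply: leq_trans (card_seq_sub_mem s (hidden om a)); apply: subset_leq_card.
  by apply/subsetP => x; rewrite !inE => /andP[].
- move=> a b; rewrite !inE => /andP[_ nga] /andP[bM0 _] ab.
  move: nga; rewrite negb_exists_in => /forall_inP /(_ b bM0).
  rewrite eq_sym ab /= => /allPn[p pb]; rewrite negb_imply => /andP[pa pna].
  have ps : p \in s by apply: (sP a); rewrite mem_cat pa.
  by exists (SeqSub ps); rewrite !inE /= pa pna pb.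
Qed.

Lemma agree_hidden om f a : agree (ext om.2) (ext f) (hidden om a) ->
  [/\ keys (om.1, f) = keys om, sig (om.1, f) a = sig om a &
      hidden (om.1, f) a = hidden om a].
Proof.
move=> fP; have gP := agree_catl fP; have sP := agree_catr fP.
have kE : keys (om.1, f) = keys om by apply: agree_run.
split=> //; first by rewrite /sig kE; apply: agree_run.
by rewrite /hidden /sign_queries kE /= (agree_queries gP) (agree_queries sP).
Qed.

Definition state := ({set world} * seq point)%type.

Definition refine (st : state) l (x : l.-tuple bool) y : state :=
  ([set om in st.1 | ext om.2 l x == y]%SET, pt x :: st.2).

Lemma sum_refine (st : state) l (x : l.-tuple bool)
    (f : world -> l.-tuple bool -> R) :
  \sum_(om in st.1) f om (ext om.2 l x) =
  \sum_y \sum_(om in (refine st x y).1) f om y.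
Proof.
rewrite (partition_big (fun om : world => ext om.2 l x) xpredT)//=.
apply: eq_bigr => y _; apply: eq_big => om; first by rewrite inE.
by move=> /andP[_ /eqP ->].
Qed.

Inductive refining : state -> oalg state -> Prop :=
| refining_ret st : refining st (Ret st)
| refining_query st l (x : l.-tuple bool) k :
    (forall y, refining (refine st x y) (k y)) -> refining st (Query x k).

Lemma sum_refining st t (pay : world -> state -> R) : refining st t ->
  (forall om, om \in st.1 ->
     0 <= \sum_(om' in (run (ext om.2) t).1) pay om' (run (ext om.2) t)) ->
  0 <= \sum_(om in st.1) pay om (run (ext om.2) t).
Proof.
elim=> {st t} [st|st l x k _ IH] /= h.
  have [->|[om omst]] := set_0Vmem st.1; first by rewrite big_set0.
  exact: h omst.
rewrite (sum_refine st x (fun om y => pay om (run (ext om.2) (k y)))).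
apply: sumr_ge0 => y _; apply: IH => om; rewrite inE => /andP[omst /eqP <-].
exact: h.
Qed.

Lemma refining_sub O st t : refining st t ->
  (run O t).1 \subset st.1 /\ {subset st.2 <= (run O t).2}.
Proof.
elim=> {st t} [st|st l x k _ IH] /=; first by split.
have [IH1 IH2] := IH (O l x); split.
  by apply: (subset_trans IH1); apply/subsetP => om; rewrite inE => /andP[].
by move=> p pst; apply: IH2; rewrite inE pst orbT.
Qed.

Fixpoint observe A (t : oalg A) (st : state) : oalg state :=
  match t with
  | Ret _ => Ret st
  | Query l x k => Query x (fun y => observe (k y) (refine st x y))
  end.

Lemma observe_refining A (t : oalg A) st : refining st (observe t st).
Proof. by elim: t st => [a|l x k IH] st /=; constructor. Qed.

Lemma nqueries_observe A O (t : oalg A) st :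
  nqueries O (observe t st) = nqueries O t.
Proof. by elim: t st => [a|l x k IH] st //=; rewrite IH. Qed.

Lemma observe_queries A O (t : oalg A) (st : state) om :
  om \in (run O (observe t st)).1 ->
  {subset queries (ext om.2) t <= (run O (observe t st)).2}.
Proof.
elim: t st => [a|l x k IH] st //= omst.
have [sub1 sub2] := refining_sub O (observe_refining (k (O l x)) (refine st x (O l x))).
have := subsetP sub1 _ omst; rewrite inE => /andP[_ /eqP ->] p.
rewrite inE => /predU1P[->|]; last exact: IH.
by apply: sub2; rewrite mem_head.
Qed.

Section FixedMessage.

Variables (a : M) (eps : R) (K : nat).
Hypothesis eps_gt0 : 0 < eps.

Definition mass (st : state) : R := \sum_(om in st.1) w om.1.

(* The last clause makes the values outside of the hidden queries and of the
   learned points free, which is what exchanging two worlds requires. *)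
Definition consistent vk (st : state) : Prop :=
  [/\ forall om, om \in st.1 -> (keys om).2 = vk,
      forall om om', om \in st.1 -> om' \in st.1 ->
        agree (ext om.2) (ext om'.2) st.2
    & forall om f, om \in st.1 ->
        agree (ext om.2) (ext f) (hidden om a ++ st.2) -> (om.1, f) \in st.1].

Lemma consistent_refine vk st l (x : l.-tuple bool) y :
  consistent vk st -> consistent vk (refine st x y).
Proof.
move=> [kst ast cst]; split.
- by move=> om; rewrite inE => /andP[/kst].
- move=> om om'; rewrite !inE => /andP[omst /eqP omx] /andP[om'st /eqP om'x].
  by apply: agree_cons; [rewrite omx om'x|exact: ast].
- move=> om f; rewrite !inE => /andP[omst /eqP omx] fP; apply/andP; split.
    apply: cst => // l' x' x'P; apply: fP; move: x'P.
    by rewrite !mem_cat inE => /orP[] ->; rewrite ?orbT.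
  by rewrite /= -fP ?omx// mem_cat mem_head orbT.
Qed.

Lemma refining_consistent vk O st t :
  refining st t -> consistent vk st -> consistent vk (run O t).
Proof.
elim=> {st t} [st|st l x k _ IH] //= cst; apply: IH; exact: consistent_refine.
Qed.

Definition initial vk s : state :=
  ([set om | ((keys om).2 == vk) && (sig om a == s)]%SET, [::]).

Lemma consistent_initial vk s : consistent vk (initial vk s).
Proof.
split=> [om|//|om f]; rewrite !inE => /andP[/eqP // ks /eqP ss].
by rewrite cats0 => /agree_hidden[-> -> _]; rewrite ks ss !eqxx.
Qed.

Definition hidden_mass (st : state) p : R :=
  \sum_(om in st.1 | p \in hidden om a) w om.1.

Definition heavy (st : state) p : Prop :=
  p \notin st.2 /\ eps * mass st < hidden_mass st p.

Definition heavy_point (st : state) : option point :=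
  if pselect (exists p, heavy st p) is left e then Some (projT1 (cid e)) else None.

Definition light (st : state) : bool := ~~ heavy_point st.

Lemma heavy_pointP st p : heavy_point st = Some p -> heavy st p.
Proof.
by rewrite /heavy_point; case: pselect => // e [<-]; exact: (projT2 (cid e)).
Qed.

Lemma light_le (st : state) p : light st -> p \notin st.2 ->
  hidden_mass st p <= eps * mass st.
Proof.
rewrite /light /heavy_point; case: pselect => // ne _ pst.
by rewrite leNgt; apply/negP => hp; apply: ne; exists p.
Qed.

Fixpoint learn (n : nat) (st : state) : oalg state :=
  match n, heavy_point st with
  | n'.+1, Some p =>
      Query (projT2 p) (fun y => learn n' (refine st (projT2 p) y))
  | _, _ => Ret st
  end.

Lemma learn_refining n st : refining st (learn n st).
Proof.
elim: n st => [|n IH] st /=; first exact: refining_ret.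
case: heavy_point => [p|]; last exact: refining_ret.
by apply: refining_query => y; exact: IH.
Qed.

Lemma nqueries_learn O n st : (nqueries O (learn n st) <= n)%N.
Proof. by elim: n st => [|n IH] st //=; case: heavy_point => [p|] //=; rewrite ltnS IH. Qed.


Definition unlearned (st : state) om : nat :=
  count (fun p => p \notin st.2) (undup (hidden om a)).

Definition potential (st : state) : R :=
  \sum_(om in st.1) w om.1 * (unlearned st om)%:R.

Lemma mass_ge0 st : 0 <= mass st.
Proof. by apply: sumr_ge0 => om _; rewrite ltW. Qed.

Lemma potential_ge0 st : 0 <= potential st.
Proof. by apply: sumr_ge0 => om _; rewrite mulr_ge0// ltW. Qed.

Lemma unlearned_cons (st : state) p om : p \notin st.2 ->
  unlearned st om = ((p \in hidden om a) + unlearned (st.1, p :: st.2) om)%N.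
Proof.
move=> pst; rewrite /unlearned -mem_undup; set s := undup _.
rewrite -(count_uniq_mem p (undup_uniq (hidden om a))) -/s -count_predUI.
rewrite [X in (_ + X)%N](_ : _ = 0)%N ?addn0.
  apply: eq_count => p' /=; rewrite inE negb_or.
  by case: eqVneq => [->|]//=; rewrite pst.
apply/eqP; rewrite -leqn0 leqNgt -has_count; apply/hasPn => p' _ /=.
by rewrite inE negb_or; case: eqVneq.
Qed.

Lemma potential_le st : potential st <= q%:R * mass st.
Proof.
rewrite mulr_sumr; apply: ler_sum => om _; rewrite mulrC ler_pM2r//.
rewrite ler_nat (leq_trans (count_size _ _))// (leq_trans (size_undup _))//.
by apply: leq_trans (size_hidden_ver om a); rewrite leq_addr.
Qed.

(* Each query at a heavy point lowers the expected number of unlearned hidden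
   queries by more than eps. *)
Lemma learn_unfinished n (st : state) :
  eps * n%:R * (\sum_(om in st.1)
    w om.1 * (~~ light (run (ext om.2) (learn n st)))%:R) <= potential st.
Proof.
elim: n st => [|n IH] st; first by rewrite mulr0 mul0r potential_ge0.
rewrite /=; case hp : (heavy_point st) => [p|]; last first.
  rewrite big1 ?mulr0 ?potential_ge0// => om _ /=.
  by rewrite /light hp /= mulr0.
case: p hp => l x hp /=; have [pst hmass] := heavy_pointP hp.
set u := \sum_(om in st.1) _.
have u_le : u <= mass st.
  apply: ler_sum => om _; rewrite ler_piMr//; first by rewrite ltW.
  by case: (~~ _).
have -> : eps * n.+1%:R * u = eps * n%:R * u + eps * u.
  by rewrite -natr1 mulrDr mulr1 mulrDl.
have -> : potential st = hidden_mass st (pt x) +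
    \sum_y potential (refine st x y).
  rewrite /potential -(sum_refine st x (fun om _ =>
    w om.1 * (unlearned (st.1, pt x :: st.2) om)%:R)).
  rewrite /hidden_mass big_mkcondr -big_split /=; apply: eq_bigr => om _.
  rewrite (unlearned_cons _ pst) natrD mulrDr; congr (_ + _).
  by case: ifP => _; rewrite ?mulr1 ?mulr0.
rewrite addrC lerD//.
  by apply: (le_trans _ (ltW hmass)); rewrite ler_pM2l.
rewrite /u (sum_refine st x (fun om y =>
  w om.1 * (~~ light (run (ext om.2) (learn n (refine st x y))))%:R)).
by rewrite mulr_sumr; apply: ler_sum => y _; exact: IH.
Qed.

Definition hybrid om : partial_oracle := fun l x =>
  if pt x \in hidden om a then Some (ext om.2 l x) else None.

Definition forged (om om' : world) b :=
  run (overlay (hybrid om') (ext om.2)) (sg (keys om').1 b).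

Definition succeeds (om om' : world) b : bool :=
  [&& b \in M0, b != a &
      run (ext om.2) (vr (keys om).2 b (forged om om' b))].

Definition exposed om om' (L : seq point) := hidden om a ++ (hidden om' a ++ L).

Lemma mem_exposed om om' L p : (p \in exposed om om' L) =
  [|| p \in hidden om a, p \in hidden om' a | p \in L].
Proof.
by rewrite /exposed; move: (hidden _ _) (hidden _ _) => s s'; rewrite !mem_cat.
Qed.

Definition swap (L : seq point) (p : world * world) : world * world :=
  let D := exposed p.1 p.2 L in
  ((p.1.1, mix p.1.2 p.2.2 D), (p.2.1, mix p.2.2 p.1.2 D)).

Lemma agree_mix f f' D s : {subset s <= D} -> agree (ext f) (ext (mix f f' D)) s.
Proof. by move=> sD l x /sD xD; rewrite mixE xD. Qed.

Lemma swap_hidden L p :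
  [/\ keys (swap L p).1 = keys p.1, hidden (swap L p).1 a = hidden p.1 a,
      keys (swap L p).2 = keys p.2 & hidden (swap L p).2 a = hidden p.2 a].
Proof.
have [k1 _ h1] : [/\ keys (swap L p).1 = keys p.1,
    sig (swap L p).1 a = sig p.1 a & hidden (swap L p).1 a = hidden p.1 a].
  by apply: agree_hidden; apply: agree_mix => x; rewrite mem_exposed => ->.
have [k2 _ h2] : [/\ keys (swap L p).2 = keys p.2,
    sig (swap L p).2 a = sig p.2 a & hidden (swap L p).2 a = hidden p.2 a].
  by apply: agree_hidden; apply: agree_mix => x; rewrite mem_exposed => ->;
     rewrite orbT.
by [].
Qed.

Lemma swapK L : involutive (swap L).
Proof.
move=> p; have [_ h1 _ h2] := swap_hidden L p.
rewrite {1}/swap /exposed h1 h2 /swap /=; case: p {h1 h2} => [[i f] [i' f']] /=.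
by congr (_, _); congr (_, _); apply: ext_inj => l x;
   rewrite !mixE; case: ifP => ->.
Qed.

Lemma swap_cell vk (st : state) p : consistent vk st ->
  (((swap st.2 p).1 \in st.1) && ((swap st.2 p).2 \in st.1)) =
  ((p.1 \in st.1) && (p.2 \in st.1)).
Proof.
move=> [_ _ cst].
have h p' : (p'.1 \in st.1) && (p'.2 \in st.1) ->
    ((swap st.2 p').1 \in st.1) && ((swap st.2 p').2 \in st.1).
  move=> /andP[p1 p2]; apply/andP; split; apply: cst => //; apply: agree_mix => x;
    rewrite mem_exposed; move: (hidden _ _) (hidden _ _) => s s';
    by rewrite mem_cat => /orP[] ->; rewrite ?orbT.
by apply/idP/idP => [/h|/h//]; rewrite swapK.
Qed.

Lemma swap_succeeds vk (st : state) om om' b : consistent vk st ->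
  om \in st.1 -> om' \in st.1 -> {subset ver_queries om' a <= st.2} ->
  b \in M0 -> b != a -> covered om' a b ->
  (forall p, p \in sign_queries om' b ++ ver_queries om' b ->
     p \in hidden om a -> p \in st.2) ->
  succeeds (swap st.2 (om, om')).1 (swap st.2 (om, om')).2 b.
Proof.
move=> [kst ast _] omst om'st vL bM0 ba /allP cov avoid.
have [k1 h1 k2 h2] := swap_hidden st.2 (om, om').
have off l (x : l.-tuple bool) :
    pt x \in sign_queries om' b ++ ver_queries om' b ->
    pt x \notin hidden om' a ->
    ext (mix om.2 om'.2 (exposed om om' st.2)) l x =
    ext om'.2 l x.
  move=> pQ ph'; rewrite mixE mem_exposed (negbTE ph') /=.
  case: ifP => // /orP[ph|pL]; first by rewrite (ast om om')// avoid.
  by rewrite (ast om om').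
rewrite /succeeds bM0 ba k1 /=.
have -> : forged (swap st.2 (om, om')).1 (swap st.2 (om, om')).2 b = sig om' b.
  rewrite /forged k2; apply: agree_run => l x xS.
  rewrite ffunE /hybrid h2 /=.
  case: (boolP (pt x \in hidden om' a)) => [xh|xh] /=.
    by rewrite mixE mem_exposed xh orbT.
  by rewrite off// mem_cat xS.
rewrite /= (kst om omst) -(kst om' om'st) /is_true -[RHS](complete (ext om'.2) om'.1 b).
apply: agree_run => l x xV.
case: (boolP (pt x \in hidden om' a)) => [xh|xh].
  have xL : pt x \in st.2 by apply: vL; exact: (implyP (cov _ xV)).
  by rewrite mixE mem_exposed xL !orbT; exact: ast.
by rewrite off// mem_cat xV orbT.
Qed.

Definition gain (st : state) (p : world * M) : R :=
  \sum_(om in st.1) w om.1 * (succeeds om p.1 p.2)%:R.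

Definition good_mass (st : state) : R :=
  \sum_(om in st.1) w om.1 * (good a om)%:R.

Definition witness om : option M :=
  [pick b | [&& b \in M0, b != a & covered om a b]].

Definition witness_queries om : seq point :=
  if witness om is Some b then sign_queries om b ++ ver_queries om b else [::].

Lemma size_witness_queries om : (size (witness_queries om) <= q)%N.
Proof.
rewrite /witness_queries; case: witness => [b|]//.
have := size_hidden_ver om b; rewrite !size_cat -addnA; apply: leq_trans.
by rewrite leq_addl.
Qed.

Lemma swap_count vk (st : state) om om' : consistent vk st ->
  om \in st.1 -> om' \in st.1 -> {subset ver_queries om' a <= st.2} ->
  (good a om')%:R - \sum_(p <- witness_queries om' | p \notin st.2)
    (p \in hidden om a)%:R <=
  \sum_(b in M0)
    (succeeds (swap st.2 (om, om')).1 (swap st.2 (om, om')).2 b)%:R :> R.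
Proof.
move=> cst omst om'st vL.
have S0 : 0 <= \sum_(p <- witness_queries om' | p \notin st.2)
    (p \in hidden om a)%:R :> R by apply: sumr_ge0.
have T0 (P : pred M) : 0 <= \sum_(b in M0 | P b)
    (succeeds (swap st.2 (om, om')).1 (swap st.2 (om, om')).2 b)%:R :> R.
  by apply: sumr_ge0.
case: (boolP (good a om')) => [gom'|_]; last first.
  rewrite sub0r; apply: (@le_trans _ _ 0); first by rewrite oppr_le0.
  by have := T0 xpredT; under eq_bigl do rewrite andbT.
move: S0; rewrite /witness_queries /witness; case: pickP => [b|nb]; last first.
  case/exists_inP: gom' => b bM0 /andP[ba bc].
  by have := nb b; rewrite bM0 ba bc.
move=> /and3P[bM0 ba bc] S0.
set Q := sign_queries om' b ++ ver_queries om' b.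
case: (boolP (all (fun p => (p \in hidden om a) ==> (p \in st.2)) Q)).
  move=> /allP avoid; rewrite (bigD1 b)//=.
  rewrite (swap_succeeds cst)//; last by move=> p /avoid /implyP.
  by rewrite lerBlDr -addrA lerDl addr_ge0.
move=> /allPn[p pQ]; rewrite negb_imply => /andP[ph pL].
apply: (@le_trans _ _ 0); last first.
  by have := T0 xpredT; under eq_bigl do rewrite andbT.
rewrite subr_le0; move: pQ; rewrite -/Q; elim: Q {S0} => // p' Q IH.
have Q0 : 0 <= \sum_(p <- Q | p \notin st.2) (p \in hidden om a)%:R :> R.
  by apply: sumr_ge0.
rewrite inE big_cons => /predU1P[<-|/IH Q1]; first by rewrite pL ph lerDl.
by case: ifP => _ //; apply: (le_trans Q1); rewrite lerDr.
Qed.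

Lemma cell_gain vk (st : state) : consistent vk st -> light st ->
  (forall om, om \in st.1 -> {subset ver_queries om a <= st.2}) ->
  (good_mass st - eps * q%:R * mass st) * mass st <=
  \sum_(b in M0) \sum_(om' in st.1) w om'.1 * gain st (om', b).
Proof.
move=> cst lst vL.
have -> : \sum_(b in M0) \sum_(om' in st.1) w om'.1 * gain st (om', b) =
    \sum_(p : world * world | (p.1 \in st.1) && (p.2 \in st.1))
      w p.1.1 * w p.2.1 * \sum_(b in M0) (succeeds p.1 p.2 b)%:R.
  rewrite exchange_big /= -(pair_big (mem st.1) (mem st.1) (fun om om' : world =>
    w om.1 * w om'.1 * \sum_(b in M0) (succeeds om om' b)%:R)) /=.
  rewrite [RHS]exchange_big /=.
  apply: eq_bigr => om' _; under eq_bigr do rewrite mulr_sumr.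
  rewrite exchange_big /=; apply: eq_bigr => om _; rewrite mulr_sumr.
  by apply: eq_bigr => b _; rewrite mulrA (mulrC (w om'.1)).
rewrite (reindex_inj (inv_inj (swapK st.2))) /=.
under eq_bigl do rewrite (swap_cell _ cst).
rewrite -(pair_big (mem st.1) (mem st.1) (fun om om' : world =>
  w om.1 * w om'.1 * \sum_(b in M0)
    (succeeds (swap st.2 (om, om')).1 (swap st.2 (om, om')).2 b)%:R)) /=.
rewrite exchange_big /=.
have -> : (good_mass st - eps * q%:R * mass st) * mass st =
    \sum_(om' in st.1) (w om'.1 * (good a om')%:R * mass st -
      w om'.1 * (eps * q%:R * mass st)).
  by rewrite sumrB -!mulr_suml mulrBl; congr (_ - _); rewrite mulrC.
apply: ler_sum => om' om'st.
apply: (@le_trans _ _ (\sum_(om in st.1) w om.1 * w om'.1 *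
  ((good a om')%:R - \sum_(p <- witness_queries om' | p \notin st.2)
    (p \in hidden om a)%:R))); last first.
  apply: ler_sum => om omst; rewrite ler_pM2l ?mulr_gt0//.
  by apply: (swap_count cst) => //; exact: vL.
under [leRHS]eq_bigr do rewrite mulrBr.
rewrite sumrB lerB//.
  by rewrite /mass mulr_sumr; apply: ler_sum => om _; rewrite [leLHS]mulrC mulrA.
under eq_bigr do rewrite -mulrA mulrCA mulr_sumr.
rewrite -mulr_sumr exchange_big /= ler_pM2l//.
apply: (@le_trans _ _ (\sum_(p <- witness_queries om' | p \notin st.2)
  eps * mass st)).
  apply: ler_sum => p pL; apply: le_trans (light_le lst pL).
  rewrite /hidden_mass big_mkcondr; apply: ler_sum => om _.
  by case: ifP => _; rewrite ?mulr1 ?mulr0.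
rewrite big_const_seq iter_addr_0 -[leLHS]mulr_natl mulrA (mulrC _ eps).
rewrite ler_wpM2r ?mass_ge0// ler_pM2l//.
rewrite ler_nat; apply: leq_trans (size_witness_queries om').
exact: count_size.
Qed.

Definition attack (st : state) : option (world * M) :=
  [pick p | good_mass st - eps * q%:R * mass st <= 2 ^+ q * gain st p].

Lemma attackP vk (st : state) : consistent vk st -> light st ->
  (forall om, om \in st.1 -> {subset ver_queries om a <= st.2}) ->
  st.1 != set0 -> exists2 p, attack st = Some p &
    good_mass st - eps * q%:R * mass st <= 2 ^+ q * gain st p.
Proof.
move=> cst lst vL /set0Pn[om0 om0st]; rewrite /attack.
case: pickP => [p pP|nP]; first by exists p.
have m_gt0 : 0 < mass st.
  rewrite /mass (bigD1 om0)//= ltr_pwDl//.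
  by apply: sumr_ge0 => om _; exact: ltW.
have := cell_gain cst lst vL; rewrite leNgt => /negP[].
set Y := _ - _.
have lt_gain om' b : gain st (om', b) < Y / 2 ^+ q.
  by rewrite ltr_pdivlMr ?exprn_gt0// mulrC ltNge nP.
have -> : Y * mass st = \sum_(b in M0) \sum_(om' in st.1) w om'.1 * (Y / 2 ^+ q).
  rewrite sumr_const cardM0 -mulr_suml -[RHS]mulr_natl natrX -/(mass st).
  by field; rewrite expf_neq0.
have [b0 b0M0] : exists b, b \in M0.
  by apply/set0Pn; rewrite -card_gt0 cardM0 expn_gt0.
apply: ltr_sum; first by apply/hasP; exists b0 => //; rewrite mem_index_enum.
move=> b _; apply: ltr_sum.
  by apply/hasP; exists om0 => //; rewrite mem_index_enum.
by move=> om' _; rewrite ltr_pM2l.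
Qed.

Definition first_state om : state :=
  run (ext om.2) (observe (vr (keys om).2 a (sig om a))
    (initial (keys om).2 (sig om a))).

Definition final_state om : state := run (ext om.2) (learn K (first_state om)).

Definition hits (st : state) om : bool :=
  if attack st is Some p then succeeds om p.1 p.2 else false.

Definition wins om := hits (final_state om) om.

Definition adversary_tree vk s : oalg (M * bitstring) :=
  cap (a, [::]) (2 * q + K)
    (obind (observe (vr vk a s) (initial vk s)) (fun st =>
     obind (learn K st) (fun st' =>
       if attack st' is Some p then
         obind (simulate (hybrid p.1) (sg (keys p.1).1 p.2))
           (fun s' => Ret (p.2, s'))
       else Ret (a, [::])))).

Lemma run_adversary_tree om p : attack (final_state om) = Some p ->
  run (ext om.2) (adversary_tree (keys om).2 (sig om a)) =
  (p.2, forged om p.1 p.2).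
Proof.
move=> pP; rewrite run_cap.
  by rewrite 2!run_obind -/(first_state om) -/(final_state om) pP run_obind
             run_simulate.
rewrite 2!nqueries_obind -/(first_state om) -/(final_state om) pP.
rewrite nqueries_obind /= addn0 nqueries_observe mul2n -addnn -addnA.
apply: leq_add; first by apply: leq_trans (q_bound (ext om.2) om.1 a); rewrite leq_addl.
rewrite addnC leq_add ?nqueries_learn//.
apply: (leq_trans (nqueries_simulate _ _ _)).
set O := overlay _ _.
have gE : run O (g p.1.1) = keys p.1.
  apply: agree_run => l x xG; rewrite ffunE /hybrid /hidden mem_cat xG //.
apply: leq_trans (q_bound O p.1.1 p.2); rewrite gE -addnA addnCA.
exact: leq_addr.
Qed.

Definition unfinished_from (st : state) (om : world) : R :=
  (~~ light (run (ext om.2) (learn K st)))%:R.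

Definition unfinished om : R := unfinished_from (first_state om) om.

Lemma class_attack om0 :
  0 <= \sum_(om in (initial (keys om0).2 (sig om0 a)).1) w om.1 *
    (2 ^+ q * (wins om)%:R + unfinished om + eps * q%:R - (good a om)%:R).
Proof.
set vk := (keys om0).2; set s := sig om0 a; set st := initial vk s.
have stP om : om \in st.1 -> (keys om).2 = vk /\ sig om a = s.
  by rewrite inE => /andP[/eqP -> /eqP ->].
pose pay om st' := w om.1 *
  (2 ^+ q * (hits st' om)%:R +
   (~~ light st')%:R + eps * q%:R - (good a om)%:R).
rewrite (eq_bigr (fun om => (fun om st1 => pay om (run (ext om.2) (learn K st1))) om
  (run (ext om.2) (observe (vr vk a s) st)))); last first.
  move=> om /stP[kE sE].
  by rewrite /pay /unfinished /unfinished_from /wins /final_state /first_state kE sE.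
apply: (sum_refining (pay := fun om st1 => pay om (run (ext om.2) (learn K st1)))).
  exact: observe_refining.
move=> om1 om1st; set st1 := run _ _.
have ref1 := observe_refining (vr vk a s) st.
have c1 : consistent vk st1.
  by apply: (refining_consistent _ ref1); exact: consistent_initial.
apply: (sum_refining (pay := pay)); first exact: learn_refining.
move=> om2 om2st1; set st2 := run _ _.
have ref2 := learn_refining K st1.
have c2 : consistent vk st2 by exact: (refining_consistent _ ref2).
have [sub1 _] := refining_sub (ext om1.2) ref1.
have [sub2 sub2'] := refining_sub (ext om2.2) ref2.
have vL om : om \in st2.1 -> {subset ver_queries om a <= st2.2}.
  move=> om_st2 p; have om_st1 := subsetP sub2 _ om_st2.
  have [kE sE] := stP _ (subsetP sub1 _ om_st1).
  rewrite /ver_queries kE sE => pV; apply: sub2'.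
  exact: (observe_queries om_st1 pV).
have [->|st2_neq0] := eqVneq st2.1 set0; first by rewrite big_set0.
case: (boolP (light st2)) => [l2|nl2]; last first.
  have nl2R : (~~ light st2)%:R = 1 :> R by rewrite nl2.
  apply: sumr_ge0 => om _; rewrite /pay nl2R mulr_ge0//; first by rewrite ltW.
  have h1 : 0 <= 2 ^+ q * (hits st2 om)%:R :> R by rewrite mulr_ge0 ?exprn_ge0.
  have h2 : 0 <= eps * q%:R by rewrite mulr_ge0// ltW.
  have h3 : (good a om)%:R <= 1 :> R by case: good.
  by lra.
have [p pE pP] := attackP c2 l2 vL st2_neq0.
rewrite /pay /hits pE l2 /=.
have -> : \sum_(om in st2.1) w om.1 * (2 ^+ q * (succeeds om p.1 p.2)%:R +
    0 + eps * q%:R - (good a om)%:R) =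
    2 ^+ q * gain st2 p + eps * q%:R * mass st2 - good_mass st2.
  rewrite /gain /mass /good_mass !mulr_sumr -big_split -sumrB /=.
  by apply: eq_bigr => om _; ring.
by rewrite subr_ge0 -lerBlDr.
Qed.

Lemma class_unfinished om0 : 8 * q%:R <= eps * K%:R ->
  0 <= \sum_(om in (initial (keys om0).2 (sig om0 a)).1) w om.1 * (8^-1 - unfinished om).
Proof.
move=> epsK; set vk := (keys om0).2; set s := sig om0 a; set st := initial vk s.
pose pay (om : world) (st1 : state) : R :=
  w om.1 * (8^-1 - unfinished_from st1 om).
rewrite (eq_bigr (fun om => pay om
  (run (ext om.2) (observe (vr vk a s) st)))); last first.
  move=> om; rewrite inE => /andP[/eqP kE /eqP sE].
  by rewrite /pay /unfinished /first_state kE sE.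
apply: (sum_refining (pay := pay)); first exact: observe_refining.
move=> om1 _; set st1 := run _ _; rewrite /pay.
under eq_bigr do rewrite mulrBr; rewrite sumrB -mulr_suml subr_ge0 -/(mass st1).
set U := \sum_(om in _) _.
have U_ge0 : 0 <= U.
  by apply: sumr_ge0 => om _; apply: mulr_ge0 => //; exact: ltW.
have q_gt0R : 0 < q%:R :> R by rewrite ltr0n.
rewrite -(ler_pM2l (_ : 0 < 8 * q%:R)) ?mulr_gt0//.
apply: (le_trans (ler_wpM2r U_ge0 epsK)).
apply: (le_trans (learn_unfinished K st1)); apply: (le_trans (potential_le st1)).
by rewrite le_eqVlt; apply/orP; left; apply/eqP; field.
Qed.

Lemma sum_classes (T : finType) (V : eqType) (v : T -> V) (f : T -> R) :
  (forall x0, 0 <= \sum_(x | v x == v x0) f x) -> 0 <= \sum_x f x.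
Proof.
move=> h; pose cls x := [set x' | v x' == v x]%SET.
rewrite (partition_big cls xpredT)//=; apply: sumr_ge0 => D _.
case: (pickP (fun x => cls x == D)) => [x0 /eqP <-|nD]; last by rewrite big_pred0.
rewrite (eq_bigl (fun x => v x == v x0)); first exact: h.
move=> x; apply/eqP/eqP => [/setP/(_ x)|e]; last by apply/setP => x'; rewrite !inE e.
by rewrite !inE eqxx => /esym/eqP.
Qed.

Lemma sum_views (f : world -> R) :
  (forall om0, 0 <= \sum_(om in (initial (keys om0).2 (sig om0 a)).1) f om) ->
  0 <= \sum_om f om.
Proof.
move=> h; apply: (sum_classes (v := fun om => ((keys om).2, sig om a))) => om0.
by have := h om0; under eq_bigl do rewrite inE.
Qed.

Lemma sum_wins : eps * q%:R = 8^-1 -> 8 * q%:R <= eps * K%:R ->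
  \sum_om w om.1 * (good a om)%:R - 4^-1 * \sum_(om : world) w om.1 <=
  2 ^+ q * \sum_om w om.1 * (wins om)%:R.
Proof.
move=> epsq epsK; have := sum_views class_attack.
have := sum_views (fun om0 => class_unfinished om0 epsK).
move=> unf_ge0 att_ge0; rewrite -subr_ge0.
suff -> : 2 ^+ q * (\sum_om w om.1 * (wins om)%:R) -
    (\sum_om w om.1 * (good a om)%:R - 4^-1 * \sum_(om : world) w om.1) =
  (\sum_om w om.1 * (8^-1 - unfinished om)) +
  \sum_om w om.1 *
    (2 ^+ q * (wins om)%:R + unfinished om + eps * q%:R - (good a om)%:R).
  exact: addr_ge0.
rewrite epsq !mulr_sumr -!sumrB -big_split /=; apply: eq_bigr => om _.
by field.
Qed.

End FixedMessage.

(* The last clause confines the forged signatures to the finitely many outputs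
   of honest signers. *)
Definition forges_honestly (a : M)
    (A : bitstring -> bitstring -> oalg (M * bitstring)) (om : world) : Prop :=
  let fo := run (ext om.2) (A (keys om).2 (sig om a)) in
  [/\ fo.1 <> a, run (ext om.2) (vr (keys om).2 fo.1 fo.2) = true &
      exists i O O', fo.2 = run O' (sg (run O (g i)).1 fo.1)].

Lemma finite_attack :
  exists (a : M) (A : bitstring -> bitstring -> oalg (M * bitstring)),
    (forall O vk s, (nqueries O (A vk s) <= 2 * q + 64 * q ^ 2)%N) /\
    4^-1 * \sum_(om : world) w om.1 <= 2 ^+ q * \sum_(om : world) w om.1 *
      `[< forges_honestly a A om >]%:R.
Proof.
have q_gt0R : 0 < q%:R :> R by rewrite ltr0n.
pose eps : R := (8 * q%:R)^-1.
have eps_gt0 : 0 < eps by rewrite invr_gt0 mulr_gt0.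
have epsq : eps * q%:R = 8^-1 by rewrite /eps; field; rewrite gt_eqF.
have epsK : 8 * q%:R <= eps * (64 * q ^ 2)%:R.
  rewrite le_eqVlt; apply/orP; left; apply/eqP.
  by rewrite /eps natrM natrX; field; rewrite gt_eqF.
have [a ag] : exists a, 2^-1 * \sum_(om : world) w om.1 <=
    \sum_(om : world) w om.1 * (good a om)%:R.
  apply: contrapT => na.
  have : \sum_(a in M0) \sum_(om : world) w om.1 * (good a om)%:R <
      \sum_(a in M0) 2^-1 * \sum_(om : world) w om.1.
    have [b0 b0M0] : exists b, b \in M0.
      by apply/set0Pn; rewrite -card_gt0 cardM0 expn_gt0.
    apply: ltr_sum; first by apply/hasP; exists b0 => //; rewrite mem_index_enum.
    by move=> a _; rewrite ltNge; apply/negP => ha; apply: na; exists a.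
  rewrite ltNge => /negP[].
  rewrite sumr_const cardM0 -[leLHS]mulr_natl mulrA mulr_sumr exchange_big /=.
  apply: ler_sum => om _; rewrite -mulr_sumr mulrC ler_pM2l//.
  rewrite -natr_sum; have := card_not_good om.
  have -> : (\sum_(b in M0) good b om = #|[set b in M0 | good b om]%SET|)%N.
    rewrite -sum1_card big_mkcond [RHS]big_mkcond /=; apply: eq_bigr => b _.
    by rewrite inE; case: (b \in M0); case: good.
  have := cardsID [set b | good b om]%SET M0; rewrite cardM0.
  have -> : (M0 :&: [set b | good b om] = [set b in M0 | good b om])%SET.
    by apply/setP => b; rewrite !inE.
  have -> : (M0 :\: [set b | good b om] = [set b in M0 | ~~ good b om])%SET.
    by apply/setP => b; rewrite !inE andbC.
  have : (2 ^ q = 2 ^ q.-1 * 2)%N by rewrite -[in LHS](prednK q_gt0) expnSr.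
  by rewrite ler_pdivrMr// -natrM ler_nat; lia.
exists a, (adversary_tree a eps (64 * q ^ 2)); split.
  by move=> O vk s; exact: nqueries_cap.
have := sum_wins a eps_gt0 epsq epsK.
set G := \sum_om _ * (good _ _)%:R in ag *; set W := \sum_om w _ in ag *.
move=> h; apply: (@le_trans _ _ (G - 4^-1 * W)); first by lra.
apply: (le_trans h); rewrite ler_pM2l ?exprn_gt0//; apply: ler_sum => om _.
rewrite ler_pM2l// /wins /hits ler_nat; case pE : attack => [p|] //.
case: (boolP (succeeds _ _ _ _)) => // /and3P[bM0 ba vP].
rewrite asboolT// /forges_honestly (run_adversary_tree pE) /=; split => //; first exact/eqP.
by exists p.1.1, (ext p.1.2); eexists.
Qed.

End FiniteAttack.

(** * Truncation of oracles and schemes *)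

Definition finite_oracle (L : nat) : finType :=
  {dffun forall l : 'I_L, {ffun l.-tuple bool -> l.-tuple bool}}.

Definition extend (L : nat) (f : finite_oracle L) : oracle := fun l =>
  match decP (@idP (l < L)%N) with
  | left lL => f (Ordinal lL)
  | right _ => [ffun x => x]
  end.

Definition restrict (L : nat) (O : oracle) : finite_oracle L :=
  [ffun l : 'I_L => O l].

Lemma extend_restrict (L : nat) (O : oracle) l : (l < L)%N ->
  extend (restrict L O) l = O l.
Proof. by rewrite /extend; case: (decP idP) => // lL _; rewrite ffunE. Qed.

Lemma extend_out (L : nat) (f : finite_oracle L) l (x : l.-tuple bool) :
  ~~ (l < L)%N -> extend f l x = x.
Proof. by rewrite /extend; case: (decP idP) => [lL|_ _]; [rewrite lL|rewrite ffunE]. Qed.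

Lemma extend_inj (L : nat) (f f' : finite_oracle L) :
  (forall l x, extend f l x = extend f' l x) -> f = f'.
Proof.
move=> ff'; apply/ffunP => -[l lL]; apply/ffunP => x.
have := ff' l x; rewrite /extend; case: (decP idP) => // lL'.
by rewrite (bool_irrelevance lL lL').
Qed.

Definition mix (L : nat) (f f' : finite_oracle L) (D : seq point) :
    finite_oracle L :=
  restrict L (fun l => [ffun x => if pt x \in D then extend f l x else extend f' l x]).

Lemma extend_mix (L : nat) (f f' : finite_oracle L) D l (x : l.-tuple bool) :
  extend (mix f f' D) l x = if pt x \in D then extend f l x else extend f' l x.
Proof.
case: (boolP (l < L)%N) => lL; first by rewrite extend_restrict// ffunE.
by rewrite !extend_out// if_same.
Qed.

Fixpoint leaves (A : Type) (t : oalg A) : seq A :=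
  match t with
  | Ret a => [:: a]
  | Query l x k => flatten [seq leaves (k y) | y <- enum {: l.-tuple bool}]
  end.

Lemma run_leaves (A : eqType) (O : oracle) (t : oalg A) : run O t \in leaves t.
Proof.
elim: t => [a|l x k IH] /=; first by rewrite mem_head.
by apply/flatten_mapP; exists (O l x); rewrite ?mem_enum ?IH.
Qed.

Fixpoint maxlen (A : Type) (t : oalg A) : nat :=
  match t with
  | Ret _ => 0
  | Query l x k => maxn l.+1 (\max_(y : l.-tuple bool) maxlen (k y))
  end.

Lemma maxlen_agree (A : Type) (O O' : oracle) (t : oalg A) (L : nat) :
  (maxlen t <= L)%N -> (forall l, (l < L)%N -> O l = O' l) ->
  run O t = run O' t.
Proof.
move=> + OO'; elim: t => [a|l x k IH] //=; rewrite geq_max => /andP[lL kL].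
rewrite OO'//; apply: IH; apply: leq_trans kL.
exact: (leq_bigmax (F := fun y : l.-tuple bool => maxlen (k y)) (O' l x)).
Qed.

Definition clip (L : nat) : partial_oracle := fun l x =>
  if (l < L)%N then None else Some x.

Lemma run_clip (A : Type) (L : nat) (O : oracle) (t : oalg A) :
  run O (simulate (clip L) t) = run (extend (restrict L O)) t.
Proof.
rewrite run_simulate; apply: agree_run => l x _; rewrite ffunE /clip.
by case: ifP => lL /=; [rewrite extend_restrict|rewrite extend_out// lL].
Qed.

Lemma scheme_maxlen (R : realType) (M : finType)
    (Sch : oracle_signature_scheme R M) (m : nat) : exists L : nat,
  [/\ forall c, (c < m)%N -> (maxlen (gen Sch c) <= L)%N,
      forall c O a, (c < m)%N -> (maxlen (sign Sch (run O (gen Sch c)).1 a) <= L)%N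
    & forall c O c' O' O1 b, (c < m)%N -> (c' < m)%N ->
        (maxlen (ver Sch (run O (gen Sch c)).2 b
           (run O1 (sign Sch (run O' (gen Sch c')).1 b))) <= L)%N].
Proof.
pose ks := flatten [seq leaves (gen Sch c) | c <- iota 0 m].
have ksP c O : (c < m)%N -> run O (gen Sch c) \in ks.
  by move=> cm; apply/flatten_mapP; exists c; rewrite ?mem_iota ?run_leaves.
pose L1 := (\max_(c < m) maxlen (gen Sch c))%N.
pose L2 := (\max_(k <- ks) \max_(a : M) maxlen (sign Sch k.1 a))%N.
pose L3 := (\max_(k <- ks) \max_(k' <- ks) \max_(b : M)
  \max_(s <- leaves (sign Sch k'.1 b)) maxlen (ver Sch k.2 b s))%N.
have seq_max (T : eqType) (s : seq T) (f : T -> nat) x n : x \in s ->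
    (n <= f x)%N -> (n <= \max_(y <- s) f y)%N.
  by move=> xs /leq_trans; apply; exact: leq_bigmax_seq.
exists (maxn L1 (maxn L2 L3)); split=> [c cm|c O a cm|c O c' O' O1 b cm c'm].
- rewrite leq_max; apply/orP; left.
  exact: (leq_bigmax (F := fun c : 'I_m => maxlen (gen Sch c)) (Ordinal cm)).
- rewrite !leq_max; apply/or3P; apply: Or32; apply: (seq_max _ _ _ _ _ (ksP c O cm)).
  exact: (leq_bigmax (F := fun a => maxlen (sign Sch (run O (gen Sch c)).1 a))).
- rewrite !leq_max; apply/or3P; apply: Or33.
  apply: (seq_max _ _ _ _ _ (ksP c O cm)); apply: (seq_max _ _ _ _ _ (ksP c' O' c'm)).
  apply: leq_trans (leq_bigmax (F := fun b => \max_(s <- leaves (sign Sch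
    (run O' (gen Sch c')).1 b)) maxlen (ver Sch (run O (gen Sch c)).2 b s))%N b).
  exact: (seq_max _ _ _ _ _ (run_leaves O1 _)).
Qed.

Import classical_sets.
Local Open Scope classical_set_scope.

(** * From counting to the random oracle *)

Lemma measure_bigcup_finset (d : measure_display) (T : measurableType d)
    (R : realType) (mu : {measure set T -> \bar R}) (J : finType) (D : {set J})
    (F : J -> set T) :
  (forall j, measurable (F j)) ->
  (forall i j x, F i x -> F j x -> i = j) ->
  (mu (\bigcup_(j in [set j | j \in D]) F j) = \sum_(j in D) mu (F j))%E.
Proof.
move=> mF dF; rewrite measure_fin_bigcup//.
- rewrite (fsbigE (enum D)) ?enum_uniq//.
  + rewrite big_enum_cond /=; apply: eq_bigl => j.
    by rewrite andb_idr// => jD; rewrite inE.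
  + by move=> j /=; rewrite mem_enum.
  + by move=> j /= jD; rewrite mem_enum jD.
- by move=> i j _ _ [x [Fi Fj]]; exact: (dF i j x).
Qed.

Lemma probability_nat_mass (R : realType) (mu : probability nat R) :
  exists m : nat, 2^-1 <= \sum_(c < m) fine (mu [set (c : nat)]).
Proof.
have fin c : mu [set c] \is a fin_num by exact: fin_num_measure.
have E m : mu `I_m = (\sum_(c < m) fine (mu [set (c : nat)]))%:E.
  have -> : `I_m = \big[setU/set0]_(c < m) [set (c : nat)].
    rewrite -(bigcup_mkord m (fun c => [set c])).
    by apply/seteqP; split=> [k km|k [j jm ->]//]; exists k.
  rewrite measure_bigsetU//; last by move=> i j _ _ [x [-> ->]].
  by rewrite -sumEFin; apply: eq_bigr => c _; rewrite fineK.
apply: contrapT => nm.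
have : mu \o (fun m => `I_m) @ \oo --> mu (\bigcup_m `I_m).
  apply: nondecreasing_cvg_mu => //.
  move=> i j ij; apply/subsetPset => k /= /leq_trans; exact.
have -> : \bigcup_m `I_m = [set: nat].
  by apply/seteqP; split => // k _; exists k.+1 => //=.
rewrite probability_setT => cv.
suff : (1 <= (2^-1)%:E :> \bar R)%E by rewrite lee_fin; lra.
rewrite -(cvg_lim _ cv)//; apply: lime_le; first by apply/cvg_ex; eexists; exact: cv.
near=> m; rewrite /= E lee_fin leNgt; apply/negP => /ltW h.
by apply: nm; exists m.
Unshelve. all: by end_near. Qed.

Section RandomOracle.

Variables (R : realType) (d : measure_display) (Omega : measurableType d)
  (P : probability Omega R) (O : Omega -> oracle).
Hypothesis randO : random_oracle P O.

Lemma measurable_run (A : Type) (t : oalg A) (B : set A) :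
  measurable [set w | B (run (O w) t)].
Proof.
have [mO _ _] := randO.
elim: t => [a|l x k IH] /=.
  case: (pselect (B a)) => Ba.
    by rewrite (_ : [set w | B a] = setT) ?measurableT//; apply/seteqP; split.
  by rewrite (_ : [set w | B a] = set0) ?measurable0//; apply/seteqP; split.
rewrite (_ : [set w | _] = \bigcup_(f in [set: {ffun l.-tuple bool -> l.-tuple bool}])
    ([set w | O w l = f] `&` [set w | B (run (O w) (k (f x)))])).
  apply: fin_bigcup_measurable => [|f _]; first exact: finite_finset.
  by apply: measurableI; [exact: mO|exact: IH].
apply/seteqP; split => w /= => [Bw|[f _ [<-]]//].
by exists (O w l).
Qed.

Definition oracle_cell L (f : finite_oracle L) := [set w | restrict L (O w) = f].

Lemma oracle_cellE L (f : finite_oracle L) :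
  oracle_cell f = [set w | forall l, l \in iota 0 L -> O w l = extend f l].
Proof.
apply/seteqP; split=> w /=.
  by move=> <- l; rewrite mem_iota => /= lL; rewrite extend_restrict.
move=> wf; apply: extend_inj => l x; case: (boolP (l < L)%N) => lL.
  by rewrite extend_restrict// wf// mem_iota.
by rewrite !extend_out.
Qed.

Lemma measurable_oracle_cell L (f : finite_oracle L) :
  measurable (oracle_cell f).
Proof.
have [mO _ _] := randO.
rewrite oracle_cellE.
rewrite (_ : [set w | _] = \bigcap_(l in `I_L) [set w | O w l = extend f l]).
  by apply: fin_bigcap_measurable => [|l _]; [exact: finite_II|exact: mO].
apply/seteqP; split=> w /= h l; first by move=> lL; apply: h; rewrite mem_iota.
by rewrite mem_iota => /= lL; apply: h.
Qed.

Lemma probability_oracle_cell L : exists u : R,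
  (forall f : finite_oracle L, P (oracle_cell f) = u%:E) /\
  #|finite_oracle L|%:R * u = 1.
Proof.
have [_ PO iO] := randO.
pose u : R := \prod_(l <- iota 0 L)
  (#|{: {ffun l.-tuple bool -> l.-tuple bool}}|%:R)^-1.
have Pu (f : finite_oracle L) : P (oracle_cell f) = u%:E.
  rewrite oracle_cellE iO ?iota_uniq// /u; elim: (iota 0 L) => [|l s IH].
    by rewrite !big_nil.
  by rewrite !big_cons IH PO EFinM.
exists u; split=> //; apply: EFin_inj; rewrite -(probability_setT P).
rewrite (_ : setT = \bigcup_(f in [set f : finite_oracle L | f \in finset.setT]) oracle_cell f).
  rewrite measure_bigcup_finset; last by move=> f f' w <- <-.
    rewrite (eq_bigr (fun=> u%:E)); last by move=> f _; exact: Pu.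
    by rewrite sumEFin sumr_const cardsT mulr_natl.
  exact: measurable_oracle_cell.
by apply/seteqP; split=> // w _; exists (restrict L (O w)) => //=;
  rewrite boot.finset.in_setT.
Qed.

End RandomOracle.

Lemma forging_attack (R : realType) (d : measure_display)
    (Omega : measurableType d) (P : probability Omega R) (O : Omega -> oracle)
    (q n : nat) (Sch : oracle_signature_scheme R (n.-tuple bool)) :
  random_oracle P O -> (1 <= q)%N -> (q <= n)%N -> total_queries_le Sch q ->
  exists (alpha : n.-tuple bool) (A : adversary R (n.-tuple bool)),
    adversary_queries_le A (2 * q + 64 * q ^ 2) /\
    ((8 * 2 ^+ q)^-1%:E <= forging_probability P O Sch A alpha)%E.
Proof.
move=> randO q_gt0 qn Sch_q.
have fin c : coins (gen Sch) [set c] \is a fin_num by exact: fin_num_measure.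
have [m mass_m] := probability_nat_mass (coins (gen Sch)).
have [L [genL signL verL]] := scheme_maxlen Sch m.
have [u [Pu cardu]] := probability_oracle_cell randO L.
pose p c : R := fine (coins (gen Sch) [set (c : nat)]).
have p_ge0 c : 0 <= p c by rewrite fine_ge0.
pose I : finType := {c : 'I_m | 0 < p c}.
pose w (i : I) := p (val i).
pose M0 := [set x in take (2 ^ q) (enum {: n.-tuple bool})]%SET.
have cardM0 : #|M0| = (2 ^ q)%N.
  rewrite cardsE; rewrite (card_uniqP _) ?take_uniq ?enum_uniq//.
  rewrite size_take -cardE card_tuple card_bool ltn_neqAle leq_exp2l// qn andbT.
  by case: eqP => [->|].
have coin_gt0 (i : I) : (0 < coins (gen Sch) [set (val (val i))])%E.
  by have := valP i; rewrite /p -lte_fin fineK.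
have complete O' (i : I) b : run O' (ver Sch (run O' (gen Sch (val i))).2 b
    (run O' (sign Sch (run O' (gen Sch (val i))).1 b))) = true.
  apply: (@perfect_completeness _ _ Sch).
  apply: (lt_le_trans (coin_gt0 i)); apply: le_measure; rewrite ?inE//.
  by move=> c /= ->; exact: surjective_pairing.
have q_bound O' (i : I) b : (nqueries O' (gen Sch (val i)) +
    nqueries O' (sign Sch (run O' (gen Sch (val i))).1 b) +
    nqueries O' (ver Sch (run O' (gen Sch (val i))).2 b
      (run O' (sign Sch (run O' (gen Sch (val i))).1 b))) <= q)%N.
  exact: (Sch_q O' (val (val i)) b (coin_gt0 i)).
have [alpha [A [A_q A_wins]]] := finite_attack (@extend_inj L) (@extend_mix L)
  (fun i : I => valP i : 0 < w i) complete q_gt0 q_bound cardM0.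
exists alpha, (Randomized (\d_(0%N : nat) : probability nat R)
  (fun _ vk s => simulate (clip L) (A vk s))).
split=> [Or c vk s|]; first exact: (leq_trans (nqueries_simulate _ _ _) (A_q _ _ _)).
set Adv := Randomized _ _.
rewrite /forging_probability; set S := (X in (_ <= _ X)%E).
set mu := (P \x coins (gen Sch) \x coins Adv)%E.
pose G om := `[< forges_honestly (@extend L) (fun i : I => gen Sch (val i))
  (sign Sch) (ver Sch) alpha A om >].
pose D := [set om | G om]%SET.
pose box (om : I * finite_oracle L) : set (Omega * nat * nat) :=
  (oracle_cell O om.2 `*` [set (val (val om.1) : nat)]) `*` [set 0%N].
have mbox om : measurable (box om).
  apply: measurableX => //; apply: measurableX => //.
  exact: (measurable_oracle_cell randO).
have mu_box om : mu (box om) = (u * w om.1)%:E.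
  rewrite /mu product_measure1E//; last first.
    by apply: measurableX => //; exact: (measurable_oracle_cell randO).
  rewrite /= diracE mem_set// mule1.
  transitivity (P (oracle_cell O om.2) *
    coins (gen Sch) [set (val (val om.1) : nat)])%E.
    by apply: product_measure1E => //; exact: (measurable_oracle_cell randO).
  by rewrite Pu EFinM /w /p fineK.
have mS : measurable S.
  rewrite (_ : S = \bigcup_c \bigcup_a
    (([set x | forges Sch Adv alpha (O x) c a] `*` [set c]) `*` [set a])).
    apply: bigcupT_measurable => c; apply: bigcupT_measurable => a.
    apply: measurableX => //; apply: measurableX => //.
    pose t := obind (gen Sch c) (fun ks => obind (sign Sch ks.1 alpha) (fun s =>
      obind (Adv a ks.2 s) (fun fo => obind (ver Sch ks.2 fo.1 fo.2) (fun b =>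
        Ret (fo, b))))).
    rewrite (_ : [set x | _] =
      [set x | [set r | r.1.1 <> alpha /\ r.2 = true] (run (O x) t)]).
      exact: (measurable_run randO).
    by apply/seteqP; split=> x; rewrite /forges /t /= !run_obind.
  apply/seteqP; split=> [[[x c] a] /= Sx|[[x c] a] [c' _ [a' _ [[/= h ->] ->]]]//].
  by exists c => //; exists a.
have BS : \bigcup_(om in [set om | om \in D]) box om `<=` S.
  move=> [[x c] a] [[i f] /=]; rewrite inE => /asboolP /=.
  case=> fo1 fo2 [i0 [Oa [Ob fo3]]].
  move=> [[/= xf ->] ->].
  have extE l : (l < L)%N -> O x l = extend f l.
    by move=> lL; rewrite -xf extend_restrict.
  have cm (i1 : I) : (val (val i1) < m)%N by exact: ltn_ord.
  have kE : run (O x) (gen Sch (val (val i))) = run (extend f) (gen Sch (val (val i))).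
    by apply: (maxlen_agree _ extE); exact: genL.
  have sE : run (O x) (sign Sch (run (O x) (gen Sch (val (val i)))).1 alpha) =
      sig (@extend L) (fun i : I => gen Sch (val i)) (sign Sch) (i, f) alpha.
    by rewrite kE; apply: (maxlen_agree _ extE); exact: signL.
  rewrite /S /forges /= sE kE run_clip xf; split => //.
  rewrite -[RHS]fo2; apply: (maxlen_agree _ extE); rewrite fo3.
  exact: verL.
have muB : (mu (\bigcup_(om in [set om | om \in D]) box om) =
    \sum_(om in D) mu (box om))%E.
  apply: measure_bigcup_finset => //.
  move=> [[i iP] f] [[i' i'P] f'] [[x c] a] [[/= <- e] _] [[/= <- e'] _].
  have ii' : i = i' by apply: val_inj; rewrite /= -e -e'.
  by congr (_, _); apply: val_inj.
have leB : (mu (\bigcup_(om in [set om | om \in D]) box om) <= mu S)%E.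
  apply: le_measure => //; rewrite inE//.
  by apply: fin_bigcup_measurable => //; exact: finite_finset.
apply: le_trans leB; rewrite muB.
rewrite (eq_bigr (fun om => (u * w om.1)%:E)); last by move=> om _; exact: mu_box.
rewrite sumEFin lee_fin -mulr_sumr.
have u_gt0 : 0 < u.
  have : 0 <= u by rewrite -lee_fin -(Pu (restrict L (O point))).
  rewrite le_eqVlt => /predU1P[u0|//].
  by move: cardu; rewrite -u0 mulr0 => /esym/eqP; rewrite oner_eq0.
have W_ge : 2^-1 <= u * \sum_(om : I * finite_oracle L) w om.1.
  rewrite -(pair_big xpredT xpredT (fun i _ => w i)) /=.
  under eq_bigr do rewrite sumr_const -mulr_natr.
  rewrite -mulr_suml mulrC -mulrA cardu mulr1; apply: (le_trans mass_m).
  rewrite (bigID (fun c : 'I_m => 0 < p c)) /= [X in _ + X]big1 ?addr0.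
    by have -> := (big_sub (fun c : 'I_m => 0 < p c)).
  by move=> c; rewrite -leNgt => pc; apply/eqP; rewrite eq_le pc fine_ge0.
have GE : \sum_(om in D) w om.1 = \sum_om w om.1 * (G om)%:R.
  rewrite big_mkcond; apply: eq_bigr => om _; rewrite inE.
  by case: (G om); rewrite ?mulr1 ?mulr0.
have G_ge : 8^-1 <= 2 ^+ q * (u * \sum_om w om.1 * (G om)%:R).
  have := ler_wpM2l (ltW u_gt0) A_wins; rewrite -/(G _) mulrCA [leRHS]mulrCA.
  by lra.
by rewrite GE invfM mulrC ler_pdivrMl ?exprn_gt0.
Qed.

Theorem theorem1p1 (R : realType) :
  exists eps : nat -> R,
    (eps q @[q --> \oo] --> (0 : R)) /\
    forall (d : measure_display) (Omega : measurableType d)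
      (P : probability Omega R) (O : Omega -> oracle),
      random_oracle P O ->
    forall q n : nat, (1 <= q)%N -> (q <= n)%N ->
    forall Sch : oracle_signature_scheme R (n.-tuple bool),
      total_queries_le Sch q ->
      black_box_security_at_most P O Sch (2 `^ ((1 + eps q) * q%:R)).
Proof.
exists (fun q => 18 / Num.sqrt q%:R); split.
  apply/cvgrPdist_le => e e_gt0; near=> q.
  have q_ge : (18 / e) ^+ 2 <= q%:R by near: q; exact: nbhs_infty_ger.
  have s_ge : 18 / e <= Num.sqrt q%:R.
    have := ler_wsqrtr q_ge.
    by rewrite sqrtr_sqr ger0_norm// divr_ge0// ltW.
  have s_gt0 : 0 < Num.sqrt q%:R :> R by apply: lt_le_trans s_ge; rewrite divr_gt0.
  rewrite sub0r normrN ger0_norm ?divr_ge0// ler_pdivrMr//.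
  by rewrite mulrC -ler_pdivrMr.
move=> d Omega P O randO q n q_gt0 qn Sch Sch_q S S_gt secS.
have [alpha [A [A_q A_wins]]] := forging_attack randO q_gt0 qn Sch_q.
have T_le : 8 * 2 ^+ q * (2 * q + 64 * q ^ 2)%:R <=
    2 `^ ((1 + 18 / Num.sqrt q%:R) * q%:R) :> R.
  have sq : Num.sqrt q%:R ^+ 2 = q%:R :> R by rewrite sqr_sqrtr.
  set s : R := Num.sqrt q%:R in sq *.
  have s_ge1 : 1 <= s by rewrite -sqrtr1 ler_wsqrtr// ler1n.
  have s_gt0 : 0 < s by exact: lt_le_trans s_ge1.
  have -> : (1 + 18 / s) * q%:R = q%:R + 18 * s.
    by rewrite -sq; field; rewrite gt_eqF.
  rewrite powRD ?implybT; last by apply/implyP => _; rewrite pnatr_eq0.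
  rewrite powR_mulrn// -mulrA mulrCA ler_pM2l ?exprn_gt0//.
  have [m [sm ms]] : exists m : nat, s <= m%:R /\ m%:R <= 2 * s.
    exists (Num.truncn s).+1; split; first by rewrite ltW// truncnS_gt.
    have : (Num.truncn s)%:R <= s by rewrite truncn_le ltW.
    by rewrite -natr1; lra.
  apply: (@le_trans _ _ (2 `^ (10 + 4 * m%:R))); last first.
    by rewrite ler_powR ?ler1n//; lra.
  rewrite powRD; last by apply/implyP => _; rewrite pnatr_eq0.
  rewrite -[in leRHS]natrM !powR_mulrn// -!natrX -!natrM ler_nat.
  have qm : (q <= m ^ 2)%N.
    by rewrite -(ler_nat R) natrX -sq ler_sqr ?nnegrE// ltW.
  have q_le : (q <= (2 ^ m) ^ 2)%N.
    by apply: (leq_trans qm); rewrite leq_exp2r// ltnW// ltn_expl.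
  have -> : (2 ^ (4 * m) = ((2 ^ m) ^ 2) ^ 2)%N by rewrite -!expnM; congr (2 ^ _)%N; lia.
  have : (q ^ 2 <= ((2 ^ m) ^ 2) ^ 2)%N by rewrite leq_exp2r.
  by move: q_gt0; rewrite -/(2 ^ 10)%N (_ : 2 ^ 10 = 1024)%N//; nia.
have S_gt0 : 0 < S.
  by apply: le_lt_trans S_gt; exact: powR_ge0.
have T1 : (1 <= 2 * q + 64 * q ^ 2)%N by rewrite addn_gt0 muln_gt0 q_gt0.
have TS : (2 * q + 64 * q ^ 2)%:R <= S.
  apply: (le_trans _ (ltW S_gt)); apply: (le_trans _ T_le).
  rewrite ler_peMl// -[leLHS]mulr1 ler_pM//.
    by rewrite ler1n.
  by rewrite exprn_ege1// ler1n.
have := secS alpha _ T1 TS A A_q; rewrite leNgt => /negP; apply.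
apply: (lt_le_trans _ A_wins); rewrite lte_fin ltr_pdivrMr//.
rewrite -ltr_pdivrMl ?invr_gt0 ?mulr_gt0 ?exprn_gt0// invrK.
exact: le_lt_trans S_gt.
Unshelve. all: by end_near. Qed.
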